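(* For every $2$-connected graph $H$, certifying the class of $H$-minor-free graphs requires certificates of $\Omega(\log n)$ bits.
   Context: All networks are finite, simple, connected graphs. A graph is $2$-connected if it has at least three vertices, is connected and has no cut-vertex. Graph $H$ is a minor of $G$ if it can be obtained from $G$ by deleting vertices, deleting edges and contracting edges; $G$ is $H$-minor-free if $H$ is not a minor of $G$. Local certification: the vertices of an $n$-vertex network carry pairwise distinct identifiers in $[1,n^k]$, for a fixed constant $k$. A certificate assignment gives each vertex $v$ a bit string $c(v)$. A verifier is a local algorithm: each vertex, from its own identifier and certificate and the identifiers and certificates of its neighbors, outputs accept or reject. A class $\mathcal{C}$ can be certified with $g(n)$ bits if there is a verifier such that (1) for every $n$-vertex graph in $\mathcal{C}$ (with any identifiers) there is a certificate assignment with certificates of at most $g(n)$ bits for which all vertices accept; (2) for every connected graph not in $\mathcal{C}$ (with any identifiers) and every certificate assignment, at least one vertex rejects. Requiring $\Omega(\log n)$ bits means that the class cannot be certified with $o(\log n)$ bits.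
   Formalization: The identifier exponent k is taken to be an integer at least 2; for k = 1 the claim fails (for H a triangle, trees are certified with 2 bits by distance mod 3 to the vertex with identifier 1), and for k = 0 no graph with two vertices has valid identifiers. *)

(* Defs.v *)
From mathcomp Require Import all_boot.
From mathcomp Require Import finmap.

Set Implicit Arguments.
Unset Strict Implicit.
Unset Printing Implicit Defensive.

Record sgraph := SGraph {
  vertex :> finType;
  adj : rel vertex;
  adj_sym : symmetric adj;
  adj_irr : irreflexive adj }.
Arguments adj {s} : rename.

Definition gconnected (G : sgraph) : Prop :=
  0 < #|G| /\ forall x y : G, connect adj x y.

Definition giso (G H : sgraph) : Prop :=
  exists f : G -> H, bijective f /\ forall x y, adj (f x) (f y) = adj x y.

Section Operations.
Variables (G : sgraph) (x y : G).

Definition del_vertex_adj : rel {z : G | z != x} :=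
  fun a b => adj (val a) (val b).

Fact del_vertex_sym : symmetric del_vertex_adj.
Proof. by move=> a b; exact: adj_sym. Qed.

Fact del_vertex_irr : irreflexive del_vertex_adj.
Proof. by move=> a; exact: adj_irr. Qed.

Definition del_vertex : sgraph := SGraph del_vertex_sym del_vertex_irr.

Definition del_edge_adj : rel G :=
  fun a b => adj a b && ([set a; b] != [set x; y]).

Fact del_edge_sym : symmetric del_edge_adj.
Proof. by move=> a b; rewrite /del_edge_adj adj_sym setUC. Qed.

Fact del_edge_irr : irreflexive del_edge_adj.
Proof. by move=> a; rewrite /del_edge_adj adj_irr. Qed.

Definition del_edge : sgraph := SGraph del_edge_sym del_edge_irr.

(* Contraction of the edge xy: y is merged into x, which keeps its name.
   Loops and parallel edges disappear. *)
Definition contract_adj : rel {z : G | z != y} :=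
  fun a b => (a != b) &&
    [|| adj (val a) (val b),
        (val a == x) && adj y (val b)
      | (val b == x) && adj (val a) y].

Fact contract_sym : symmetric contract_adj.
Proof.
move=> a b; rewrite /contract_adj eq_sym (adj_sym (val a) (val b)).
by rewrite (adj_sym y) (adj_sym (val a) y) [X in _ && (_ || X)]orbC.
Qed.

Fact contract_irr : irreflexive contract_adj.
Proof. by move=> a; rewrite /contract_adj eqxx. Qed.

Definition contract : sgraph := SGraph contract_sym contract_irr.

End Operations.

(* [minor H G]: H is a minor of G, up to isomorphism. *)
Inductive minor (H : sgraph) : sgraph -> Prop :=
| minor_iso (G : sgraph) : giso G H -> minor H G
| minor_del_vertex (G : sgraph) (x : G) :
    minor H (del_vertex x) -> minor H G
| minor_del_edge (G : sgraph) (x y : G) :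
    adj x y -> minor H (del_edge x y) -> minor H G
| minor_contract (G : sgraph) (x y : G) :
    adj x y -> minor H (contract x y) -> minor H G.

Definition minor_free (H G : sgraph) : Prop := ~ minor H G.

Definition cut_vertex (G : sgraph) (x : G) : Prop := ~ gconnected (del_vertex x).

Definition two_connected (G : sgraph) : Prop :=
  [/\ 3 <= #|G|, gconnected G & forall x : G, ~ cut_vertex x].

Definition bitstring := seq bool.

(* Own identifier, own certificate, and the set of (identifier, certificate)
   pairs of the neighbors. The same function is used at every vertex of every
   graph, and it is not given the number of vertices. *)
Definition verifier := nat -> bitstring -> {fset nat * bitstring} -> bool.

(* Pitfall: for k = 1 the identifiers are exactly 1, ..., n, so vertex 1 is a
   root for free and trees can be certified with 2 bits (distance to the root
   modulo 3); for k = 0 no graph with two vertices has valid identifiers.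
   Logarithmic lower bounds only make sense for 2 <= k. *)
Definition valid_ids (k : nat) (G : sgraph) (id : G -> nat) : Prop :=
  injective id /\ forall v, 1 <= id v <= #|G| ^ k.

Definition accepts (A : verifier) (G : sgraph) (id : G -> nat)
    (c : G -> bitstring) (v : G) : bool :=
  A (id v) (c v) [fset (id u, c u) | u in G & adj v u]%fset.

(* Networks are connected: only connected graphs are considered, both inside
   and outside the class. Soundness does not bound the certificate sizes. *)
Definition certifiable (k : nat) (C : sgraph -> Prop) (g : nat -> nat) : Prop :=
  exists A : verifier,
    (forall (G : sgraph) (id : G -> nat),
       gconnected G -> C G -> valid_ids k id ->
       exists c : G -> bitstring,
         (forall v, size (c v) <= g #|G|) /\ (forall v, accepts A id c v)) /\
    (forall (G : sgraph) (id : G -> nat) (c : G -> bitstring),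
       gconnected G -> ~ C G -> valid_ids k id ->
       exists v, ~~ accepts A id c v).

(* Main.v *)
Require Import Defs.
From mathcomp Require Import all_boot all_algebra.
From mathcomp Require Import all_classical all_reals all_analysis.
From mathcomp Require Import order perm finmap zify lra.

(* Remove an edge xy from H and chain m copies of H - xy, the vertex y of each
   copy being linked to the vertex x of the next one. A 2-connected minor of a
   path of copies lives inside a single copy, so the path is H-minor-free; a ring
   of copies contains H, the rest of the ring replacing xy in any given copy.

   Give the copies fixed blocks of identifiers and arrange them along the path in
   all m! orders. With o(log n) bits there are m^o(m) possible assignments of
   certificates to the copies, so some assignment serves more than L^m orders,
   where L = sqrt m. At most L^m orders s' never step back by L or more relative to
   a given order s, so some step of s' closes a segment of s into a ring of more
   than L copies in which every vertex has a view from s or from s' and accepts.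
   The ring has at least sqrt n vertices, so its identifiers are still valid. *)

Import Order.TTheory GRing.Theory Num.Theory.

Set Implicit Arguments.
Unset Strict Implicit.
Unset Printing Implicit Defensive.

(** * Minors and branch sets *)

Lemma connect_homo (T T' : finType) (e : rel T) (e' : rel T') (f : T -> T') :
  (forall a b, e a b -> connect e' (f a) (f b)) ->
  forall a b, connect e a b -> connect e' (f a) (f b).
Proof.
move=> ef a b /connectP[p]; elim: p a => [|c p IHp] a /=.
  by move=> _ ->; exact: connect0.
by case/andP=> /ef ac pc lastp; exact: connect_trans ac (IHp _ pc lastp).
Qed.

Lemma connect_crossing (T : finType) (e : rel T) (S : pred T) a b :
    connect e a b -> S a -> ~~ S b ->
  exists u v, [/\ connect e a u, e u v, S u & ~~ S v].
Proof.
case/connectP=> p; elim: p a => [|c p IHp] a /= => [_ -> -> //|].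
case/andP=> eac pc lastp Sa NSb; have [Sc|NSc] := boolP (S c); last first.
  by exists a, c; split=> //; exact: connect0.
have [u [v [cu uv Su NSv]]] := IHp c pc lastp Sc NSb.
by exists u, v; split=> //; exact: connect_trans (connect1 eac) cu.
Qed.

Definition fibre_adj (G : sgraph) (T : eqType) (f : G -> T) : rel G :=
  fun a b => adj a b && (f a == f b).

Lemma connect_fibre (G : sgraph) (T : eqType) (f : G -> T) a b :
  connect (fibre_adj f) a b -> f a = f b.
Proof.
case/connectP=> p; elim: p a => [|c p IHp] a /= => [_ -> //|].
by case/andP=> /andP[_ /eqP->]; exact: IHp.
Qed.

(* The branch set of [h] is the set of vertices mapped to [Some h]; the
   vertices mapped to [None] lie in no branch set. *)
Definition minor_model (H G : sgraph) (f : G -> option H) : Prop :=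
  [/\ forall h, exists v, f v = Some h,
      forall u v, f u = f v -> f u != None -> connect (fibre_adj f) u v
    & forall h k, adj h k ->
        exists u v, [/\ f u = Some h, f v = Some k & adj u v]].

Section MinorModel.
Variable H : sgraph.

Lemma minor_model_iso (G : sgraph) :
  giso G H -> exists f : G -> option H, minor_model f.
Proof.
case=> f [[g fK gK] fadj]; exists (fun v => Some (f v)); split.
- by move=> h; exists (g h); rewrite gK.
- by move=> u v [/(can_inj fK)->] _; exact: connect0.
- by move=> h k hk; exists (g h), (g k); rewrite -fadj !gK.
Qed.

Lemma minor_model_del_vertex (G : sgraph) (x : G)
    (f : del_vertex x -> option H) :
  minor_model f -> exists f' : G -> option H, minor_model f'.
Proof.
case=> fS fC fE; pose f' (z : G) := obind f (insub z : option (del_vertex x)).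
have f'E (z : del_vertex x) : f' (val z) = f z by rewrite /f' valK.
have f'N z : f' z != None -> exists z' : del_vertex x, val z' = z.
  by rewrite /f'; case: insubP => // z' _ <- _; exists z'.
exists f'; split.
- by move=> h; have [v fv] := fS h; exists (val v); rewrite f'E.
- move=> u v uv Nu; have [u' uE] := f'N u Nu.
  have [v' vE] : exists v' : del_vertex x, val v' = v by apply: f'N; rewrite -uv.
  move: uv Nu; rewrite -uE -vE !f'E => uv Nu.
  apply: connect_homo (fC _ _ uv Nu) => a b /andP[ab fab].
  by apply: connect1; rewrite /fibre_adj !f'E fab andbT.
- move=> h k /fE[u [v [fu fv uv]]].
  by exists (val u), (val v); rewrite !f'E.
Qed.

Lemma minor_model_del_edge (G : sgraph) (x y : G)
    (f : del_edge x y -> option H) :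
  minor_model f -> exists f' : G -> option H, minor_model f'.
Proof.
case=> fS fC fE; exists f; split=> //.
- move=> u v uv Nu; apply: connect_sub (fC _ _ uv Nu) => a b.
  case/andP=> /andP[ab _] fab; apply: connect1; exact/andP.
- by move=> h k /fE[u [v [fu fv /andP[uv _]]]]; exists u, v.
Qed.

(** The model is pulled back along the retraction [r], where [insubd] falls back on [x'] exactly at
    [y]; thus [y] gets the value of [x]. *)
Lemma minor_model_contract (G : sgraph) (x y : G) (f : Defs.contract x y -> option H) :
  adj x y -> minor_model f -> exists f' : G -> option H, minor_model f'.
Proof.
move=> xy [fS fC fE].
have x_neq_y : x != y by apply/eqP=> exy; rewrite exy adj_irr in xy.
pose x' : Defs.contract x y := Sub x x_neq_y.
pose r (z : G) : Defs.contract x y := insubd x' z.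
have rE (z : Defs.contract x y) : r (val z) = z by rewrite /r valKd.
have rx : r x = x' by rewrite -[x in r x]/(val x') rE.
have ry : r y = x' by rewrite /r /insubd insubN // eqxx.
pose f' z := f (r z).
have f'E z : f' (val z) = f z by rewrite /f' rE.
have valr z : f' z != None -> connect (fibre_adj f') z (val (r z)).
  move=> _; have [->|zy] := eqVneq z y; last first.
    by rewrite /r val_insubd zy connect0.
  by apply: connect1; rewrite ry /= /fibre_adj adj_sym xy /f' rx ry eqxx.
have val_contract (a b : Defs.contract x y) : f a = f b -> adj a b ->
  connect (fibre_adj f') (val a) (val b).
  move=> fab /andP[_ /or3P[ab|/andP[/eqP ax yb]|/andP[/eqP bx ay]]].
  - by apply: connect1; rewrite /fibre_adj ab !f'E fab eqxx.
  - have f'y : f' y = f a by rewrite /f' ry -rx -ax rE.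
    apply: (connect_trans (connect1 (_ : fibre_adj f' (val a) y))).
      by rewrite /fibre_adj f'y f'E eqxx ax xy.
    by apply: connect1; rewrite /fibre_adj f'y f'E fab eqxx yb.
  - have f'y : f' y = f b by rewrite /f' ry -rx -bx rE.
    apply: (connect_trans (connect1 (_ : fibre_adj f' (val a) y))).
      by rewrite /fibre_adj f'y f'E fab eqxx ay.
    by apply: connect1; rewrite /fibre_adj f'y f'E eqxx bx adj_sym xy.
have fibre_sym : connect_sym (fibre_adj f').
  by apply: sym_connect_sym => a b; rewrite /fibre_adj adj_sym eq_sym.
exists f'; split.
- by move=> h; have [v fv] := fS h; exists (val v); rewrite f'E.
- move=> u v uv Nu; apply: connect_trans (valr u Nu) _.
  rewrite fibre_sym; apply: connect_trans (valr v _) _; first by rewrite -uv.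
  rewrite fibre_sym; apply: connect_homo (fC _ _ uv Nu) => a b /andP[ab /eqP fab].
  exact: val_contract.
- move=> h k /fE[u [v [fu fv]]].
  have f'y w : val w = x -> f' y = f w by move=> wx; rewrite /f' ry -rx -wx rE.
  case/andP=> _ /or3P[uv|/andP[/eqP ux yv]|/andP[/eqP vx uy]].
  + by exists (val u), (val v); rewrite !f'E.
  + by exists y, (val v); rewrite f'E (f'y u).
  + by exists (val u), y; rewrite f'E (f'y v).
Qed.

Lemma minor_has_model (G : sgraph) :
  minor H G -> exists f : G -> option H, minor_model f.
Proof.
elim=> {}G.
- exact: minor_model_iso.
- by move=> x _ [f]; exact: minor_model_del_vertex.
- by move=> x y _ _ [f]; exact: minor_model_del_edge.
- by move=> x y xy _ [f]; exact: minor_model_contract.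
Qed.

Lemma spanning_minor (G : sgraph) (f : G -> H) :
  bijective f -> (forall h k, adj h k -> exists u v, [/\ f u = h, f v = k & adj u v]) ->
  minor H G.
Proof.
move=> f_bij; have f_inj := bij_inj f_bij.
have [n] := ubnP #|[pred e : G * G | adj e.1 e.2 && ~~ adj (f e.1) (f e.2)]|.
elim: n => // n IHn in G f f_bij f_inj *.
rewrite ltnS => le_n fE.
have [[u v] /= /andP[uv Nuv]|noextra] :=
  pickP [pred e : G * G | adj e.1 e.2 && ~~ adj (f e.1) (f e.2)].
  apply: (minor_del_edge uv).
  apply: (IHn (del_edge u v) f) => //.
    apply: leq_trans le_n; apply: proper_card; apply/properP; split.
      by apply/fintype.subsetP=> -[a b]; rewrite !inE /= => /andP[/andP[-> _] ->].
    exists (u, v); rewrite !inE /= ?uv //.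
    by rewrite /del_edge_adj eqxx andbF.
  move=> h k hk; have [a [b [fa fb ab]]] := fE h k hk.
  exists a, b; split=> //; rewrite /= /del_edge_adj ab /=.
  apply: contraNneq Nuv => /setP eq_ab.
  have := eq_ab a; have := eq_ab b; rewrite !inE !eqxx orbT => /esym + /esym.
  have ab' : a != b by apply: contraTneq ab => ->; rewrite adj_irr.
  case/orP=> /eqP eb /orP[] /eqP ea; move: ab'; rewrite ?ea ?eb ?eqxx // => _.
    by rewrite -ea -eb fa fb adj_sym.
  by rewrite -ea -eb fa fb.
apply: minor_iso; exists f; split=> // a b; apply/idP/idP => [|ab].
  by case/fE=> a' [b' [/f_inj-> /f_inj->]].
by have := noextra (a, b); rewrite /= ab /= => /negbFE.
Qed.

(** Converse for maps defined on all of [G]: contracting an edge inside a fibre keeps the three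
    conditions, and once [f] is injective [spanning_minor] applies. *)
Lemma model_minor (G : sgraph) (f : G -> H) :
    (forall h, exists v, f v = h) ->
    (forall u v, f u = f v -> connect (fibre_adj f) u v) ->
    (forall h k, adj h k -> exists u v, [/\ f u = h, f v = k & adj u v]) ->
  minor H G.
Proof.
have [n] := ubnP #|G|; elim: n => // n IHn in G f *; rewrite ltnS => le_n.
move=> fS fC fE; have [/injectiveP f_inj|Ninj] := boolP (injectiveb f).
  apply: (spanning_minor (f := f)) => //.
  by have [g gK] := choice fS; exists g => // v; exact: f_inj.
have [x [y [xy fxy]]] : exists x y : G, adj x y /\ f x = f y.
  case/injectivePn: Ninj => u [v uv fuv].
  case/connectP: (fC _ _ fuv) => [[|w p] /=]; first by move=> _ e; rewrite e eqxx in uv.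
  by case/andP=> /andP[uw /eqP fuw] _ _; exists u, w.
have x_neq_y : x != y by apply/eqP=> exy; rewrite exy adj_irr in xy.
pose x' : Defs.contract x y := Sub x x_neq_y.
pose r (z : G) : Defs.contract x y := insubd x' z.
have ry : r y = x' by rewrite /r /insubd insubN // eqxx.
have rN z : z != y -> val (r z) = z by move=> zy; rewrite /r val_insubd zy.
have rE (z : Defs.contract x y) : r (val z) = z by rewrite /r valKd.
pose f' (z : Defs.contract x y) := f (val z).
have f'r z : f' (r z) = f z.
  by have [->|/rN] := eqVneq z y; rewrite ?ry /f' //= => ->.
have radj a b : adj a b -> r a != r b -> adj (r a) (r b).
  move=> ab Nab; rewrite /= /contract_adj Nab /=.
  have [ay|/rN ay] := eqVneq a y; have [by_|/rN by_] := eqVneq b y.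
  - by rewrite ay by_ eqxx in Nab.
  - by rewrite by_ ay ry /= eqxx -ay ab orbT.
  - by rewrite ay by_ ry /= eqxx -by_ ab !orbT.
  - by rewrite ay by_ ab.
apply: (minor_contract xy); apply: (IHn (Defs.contract x y) f').
- apply: leq_trans le_n; have -> : #|Defs.contract x y| = #|G|.-1.
    by rewrite card_sig -(cardC1 y); apply: eq_card.
  by rewrite prednK //; apply/card_gt0P; exists x.
- by move=> h; have [v fv] := fS h; exists (r v); rewrite f'r.
- move=> u v uv; rewrite -(rE u) -(rE v); apply: connect_homo (fC _ _ uv) => a b.
  case/andP=> ab /eqP fab; have [->|Nab] := eqVneq (r a) (r b); first exact: connect0.
  by apply: connect1; rewrite /fibre_adj !f'r fab eqxx radj.
- move=> h k hk; have [u [v [fu fv uv]]] := fE _ _ hk.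
  exists (r u), (r v); rewrite !f'r; split=> //; apply: radj => //.
  apply: contraTneq hk => ruv; rewrite -fu -fv -f'r ruv f'r adj_irr //.
Qed.

End MinorModel.

(** * 2-connected graphs and bridges *)

Lemma two_connected_avoid (H : sgraph) (z a b : H) :
  two_connected H -> a != z -> b != z ->
  connect (fun p q => [&& adj p q, p != z & q != z]) a b.
Proof.
move=> H2 az bz; case: H2 => _ _ /(_ z) /contrapT[_ Hz].
set e := fun p q => _; have homo (p q : del_vertex z) :
    adj p q -> connect e (val p) (val q).
  by move=> pq; apply: connect1; apply/and3P; split; [|exact: (valP p)|exact: (valP q)].
exact: (connect_homo homo (Hz (Sub a az) (Sub b bz))).
Qed.

Lemma two_connected_third (H : sgraph) (a b : H) : two_connected H ->
  exists c : H, (c != a) && (c != b).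
Proof.
case=> H3 _ _; have : 0 < #|~: [set a; b]|.
  have := cardsC [set a; b]; have := cards2 a b; move: H3.
  by case: (a != b) => /=; lia.
by case/card_gt0P=> c; rewrite !inE negb_or; exists c.
Qed.

Lemma two_connected_edge (H : sgraph) : two_connected H ->
  exists x y : H, adj x y.
Proof.
move=> H2; have [H3 [/card_gt0P[a _] _] _] := H2.
have [c /andP[ca _]] := two_connected_third a a H2.
have [b /andP[ba bc]] := two_connected_third a c H2.
case/connectP: (two_connected_avoid H2 ca ba) => [[|d p] /=].
  by move=> _ e; rewrite e eqxx in bc.
by case/andP=> /andP[cd _] _ _; exists c, d.
Qed.

(* A third vertex [c] yields a detour from [x] to [y]: avoid [y] from [x] to
   [c], then avoid [x] from [c] to [y]. *)
Lemma two_connected_no_bridge (H : sgraph) (x y : H) : two_connected H ->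
  adj x y -> forall a b, connect (del_edge_adj x y) a b.
Proof.
move=> H2 xy.
have x_neq_y : x != y by apply/eqP=> exy; rewrite exy adj_irr in xy.
have del_sym : connect_sym (del_edge_adj x y).
  exact: sym_connect_sym (del_edge_sym x y).
have avoid z p q : z \in [set x; y] -> p != z -> q != z ->
    connect (del_edge_adj x y) p q.
  move=> zxy pz qz; apply: connect_sub (two_connected_avoid H2 pz qz) => p' q'.
  case/and3P=> pq p'z q'z; apply: connect1; rewrite /del_edge_adj pq /=.
  by apply: contraTneq zxy => <-; rewrite !inE negb_or eq_sym p'z eq_sym q'z.
have [c /andP[cx cy]] := two_connected_third x y H2.
have xyc : connect (del_edge_adj x y) x y.
  apply: (@connect_trans _ _ c).
    by apply: (avoid y) => //; rewrite !inE eqxx orbT.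
  by apply: (avoid x); rewrite ?inE ?eqxx // eq_sym.
move=> a b; have [_ [_ Hc] _] := H2.
apply: connect_sub (Hc a b) => {}a {}b ab.
have [ab_xy|] := boolP ([set a; b] == [set x; y]); last first.
  by move=> Nxy; apply: connect1; rewrite /del_edge_adj ab.
have ab' : a != b by apply: contraTneq ab => ->; rewrite adj_irr.
move/eqP/setP: ab_xy => ab_xy.
have := ab_xy a; have := ab_xy b; rewrite !inE !eqxx orbT => /esym + /esym.
case/orP=> /eqP eb /orP[] /eqP ea; move: ab'; rewrite ?ea ?eb ?eqxx // => _.
by rewrite del_sym.
Qed.

Section Bridge.
Variables (H G : sgraph) (f : G -> option H) (S : pred G) (u v : G).
Hypotheses (H2 : two_connected H) (f_model : minor_model f).
Hypothesis bridge : forall a b, adj a b -> S a -> ~~ S b -> a = u /\ b = v.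

(** A branch set is connected within itself, and its only way across is the bridge. *)
Lemma fibre_crosses_bridge a b : f a = f b -> f a != None -> S a -> ~~ S b ->
  f u = f a /\ f v = f a.
Proof.
have [_ fC _] := f_model; move=> ab Na Sa NSb.
have [c [d [/connect_fibre ac /andP[cd /eqP fcd] Sc NSd]]] :=
  connect_crossing (fC a b ab Na) Sa NSb.
by have [<- <-] := bridge cd Sc NSd; rewrite -fcd ac.
Qed.

(* If the branch sets of [a] and [b] lay strictly on either side, every path from
   [a] to [b] in [H] would use the bridge, so deleting a vertex other than [a] and
   [b] whose branch set contains an end of the bridge would disconnect [H]. *)
Lemma bridge_dichotomy :
  (forall h, exists w, f w = Some h /\ S w) \/
  (forall h, exists w, f w = Some h /\ ~~ S w).
Proof.
pose meetS h := [exists w, (f w == Some h) && S w].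
pose meetT h := [exists w, (f w == Some h) && ~~ S w].
have meetSP h : meetS h -> exists w, f w = Some h /\ S w.
  by case/existsP=> w /andP[/eqP fw Sw]; exists w.
have meetTP h : meetT h -> exists w, f w = Some h /\ ~~ S w.
  by case/existsP=> w /andP[/eqP fw Sw]; exists w.
have [/forallP allS|/forallPn[a NSa]] := boolP [forall h, meetS h].
  by left=> h; exact: meetSP.
have [/forallP allT|/forallPn[b NTb]] := boolP [forall h, meetT h].
  by right=> h; exact: meetTP.
(* Now the branch set of [a] lies wholly outside [S] and that of [b] wholly inside. *)
exfalso; have [fS fC fE] := f_model.
have meetST h : meetS h || meetT h.
  have [w fw] := fS h; have [Sw|NSw] := boolP (S w); apply/orP; [left|right];
    by apply/existsP; exists w; rewrite fw eqxx.
have Ta : meetT a by have := meetST a; rewrite (negPf NSa).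
have Sb : meetS b by have := meetST b; rewrite (negPf NTb) orbF.
have cross h : meetS h -> meetT h -> f u = Some h /\ f v = Some h.
  case/meetSP=> p [fp Sp] /meetTP[q [fq NSq]]; rewrite -fp.
  by apply: fibre_crosses_bridge (Sp) NSq; rewrite fp.
(* A path of [H] from [p0] to [q0] avoiding [z] has an edge [pq] entering [meetS]. Its realisation
   in [G] is the bridge, or else the branch set of [q] straddles the cut and contains both ends. *)
have separated z p0 q0 : ~~ meetS p0 -> meetS q0 -> p0 != z -> q0 != z ->
    exists p q, [/\ ~~ meetS p /\ p != z, meetS q /\ q != z, f u = Some q
      & f v = Some p \/ f v = Some q /\ meetT q].
  move=> NSp0 Sq0 p0z q0z.
  have [||p [q [_ /and3P[pq pz qz] NSp]]] :=
    connect_crossing (S := predC meetS) (two_connected_avoid H2 p0z q0z) => //=.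
    by rewrite Sq0.
  rewrite negbK => Sq; exists p, q.
  have [P [Q [fP fQ PQ]]] := fE p q pq.
  have NSP : ~~ S P.
    by apply: contra NSp => SP; apply/existsP; exists P; rewrite fP eqxx.
  have [SQ|NSQ] := boolP (S Q).
    have [uQ vP] : Q = u /\ P = v by apply: bridge => //; rewrite adj_sym.
    by split; rewrite // -?uQ -?vP //; left.
  have Tq : meetT q by apply/existsP; exists Q; rewrite fQ eqxx.
  by have [fu fv] := cross q Sq Tq; split=> //; right.
have ab : a != b by apply: contraTneq Sb => <-.
have [c /andP[ca cb]] := two_connected_third a b H2.
have [] := separated c a b NSa Sb; rewrite 1?eq_sym // => p [q [[NSp _] [Sq _] fu fv]].
have neqS p' q' : ~~ meetS p' -> meetS q' -> p' != q'.
  by move=> Np'; apply: contraTneq => <-.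
(* The end [u] has a single owner: were it not [b], a path from [a] to [b] avoiding this owner would
   produce another. Likewise [v] belongs to [a]. *)
have qb : q = b.
  apply/eqP/negPn/negP=> qb.
  have [||p' [q' [_ [_ q'q] fu' _]]] := separated q a b NSa Sb; rewrite 1?eq_sym //.
    by rewrite eq_sym neqS.
  by move: q'q; rewrite fu in fu'; case: fu' => ->; rewrite eqxx.
rewrite {}qb in Sq fu fv.
have {}fv : f v = Some p by case: fv => // -[_]; rewrite (negPf NTb).
have pa : p = a.
  apply/eqP/negPn/negP=> pa.
  have [||p' [q' [[_ p'p] [_ q'p] _ fv']]] := separated p a b NSa Sb.
  - by rewrite eq_sym.
  - by rewrite eq_sym neqS.
  rewrite fv in fv'; move: p'p q'p.
  by case: fv' => [[->]|[[->] _]]; rewrite eqxx.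
rewrite {}pa in NSp fv.
(* A path from [a] to [c] avoiding [b], or from [c] to [b] avoiding [a], has to cross the cut, yet
   an end of the bridge it needs belongs to the avoided vertex. *)
have [Sc|NSc] := boolP (meetS c).
  have [||p' [q' [_ [_ q'b] fu' _]]] := separated b a c NSa Sc => //.
  by move: q'b; rewrite fu in fu'; case: fu' => ->; rewrite eqxx.
have [||p' [q' [[_ p'a] [_ q'a] _ fv']]] := separated a c b NSc Sb => //.
  by rewrite eq_sym.
rewrite fv in fv'; move: p'a q'a.
by case: fv' => [[->]|[[->] _]]; rewrite eqxx.
Qed.
End Bridge.

(** * Chains of copies of H minus an edge *)

Section Chain.
Variables (H : sgraph) (x y : H) (xy : adj x y).

Lemma edge_neq : x != y.
Proof. by apply: contraTneq xy => ->; rewrite adj_irr. Qed.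

Section Def.
Variables (I : finType) (nx : rel I).

(* [(i, a)] is the copy of [a] in the [i]-th copy of [H - xy]. *)
Definition link (u v : I * H) := [&& nx u.1 v.1, u.2 == y & v.2 == x].

Definition chain_adj : rel (I * H) := fun u v =>
  [|| (u.1 == v.1) && del_edge_adj x y u.2 v.2, link u v | link v u].

Fact chain_sym : symmetric chain_adj.
Proof. by move=> u v; rewrite /chain_adj eq_sym del_edge_sym [link u v || _]orbC. Qed.

Fact chain_irr : irreflexive chain_adj.
Proof.
move=> u; rewrite /chain_adj del_edge_irr andbF orbb /link.
apply/negbTE; apply: contra edge_neq => /and3P[_ /eqP uy /eqP ux].
by rewrite -ux uy.
Qed.

(** [nx] is arbitrary so that paths and rings are both instances; in a ring of one copy the link
    restores the edge [xy]. *)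
Definition chain : sgraph := SGraph chain_sym chain_irr.

Lemma chain_connected : two_connected H -> 0 < #|I| ->
    (forall i j, connect (fun i j => nx i j || nx j i) i j) ->
  gconnected chain.
Proof.
move=> H2 I_gt0 Ic; have [H3 _ _] := H2.
have within i a b : connect chain_adj (i, a) (i, b).
  apply: (connect_homo (f := pair i) _ (two_connected_no_bridge H2 xy a b)).
  by move=> {}a {}b ab; apply: connect1; rewrite /chain_adj /= eqxx ab.
split; first by rewrite card_prod muln_gt0 I_gt0; apply: ltn_trans H3.
move=> [i a] [j b]; apply: connect_trans (within i a x) _.
apply: connect_trans (within j x b).
apply: (connect_homo (f := fun i => (i, x)) _ (Ic i j)) => {}i {}j.
case/orP=> ij; [apply: connect_trans (within i x y) _ | apply: connect_trans _ (within j y x)];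
  by apply: connect1; rewrite /chain_adj /link /= ij !eqxx ?orbT.
Qed.

End Def.

(** Copy 0 keeps its names and all other copies collapse to [x]; the way from [(0, y)] round the
    ring back to [(0, x)] replaces the missing edge. *)
Lemma ring_minor (l : nat) : two_connected H ->
  minor H (chain (fun i j : 'I_l.+1 => j == ordS i)).
Proof.
move=> H2; set nx := fun _ => _.
pose f (v : chain nx) : H := if v.1 == ord0 then v.2 else x.
have f0 h : f (ord0, h) = h by [].
have to0 (i : 'I_l.+1) h : f (i, h) = x ->
    connect (fibre_adj f) ((i, h) : chain nx) (ord0, x).
  have [n] := ubnP (l - i); elim: n => // n IHn in i h *; rewrite ltnS => le_n.
  have [->|i0] := eqVneq i ord0; first by rewrite f0 => ->; exact: connect0.
  move=> _; apply: (@connect_trans _ _ (i, y)).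
    apply: (connect_homo (f := pair i) _ (two_connected_no_bridge H2 xy h y)).
    move=> {le_n}a b ab; apply: connect1.
    by rewrite /fibre_adj /= /chain_adj /= /f /= eqxx ab (negPf i0) eqxx.
  apply: (@connect_trans _ _ (ordS i, x)).
    apply: connect1; rewrite /fibre_adj /= /chain_adj /link /nx /f /= !eqxx orbT.
    by rewrite (negPf i0) if_same eqxx.
  have [Si0|Si0] := eqVneq (ordS i) ord0; first by rewrite Si0 connect0.
  have Si : ordS i = i.+1 :> nat.
    rewrite /= modn_small // ltnS ltn_neqAle -ltnS ltn_ord andbT.
    by apply: contraNneq Si0 => il; apply/eqP/val_inj; rewrite /= il modnn.
  apply: IHn; last by rewrite /f (negPf Si0).
  by have := ltn_ord (ordS i); rewrite Si; lia.
have fibre_sym : connect_sym (fibre_adj f).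
  by apply: sym_connect_sym => a b; rewrite /fibre_adj adj_sym eq_sym.
have link0 : adj ((ord0, y) : chain nx) (ordS ord0, x).
  by rewrite /= /chain_adj /link /nx /= !eqxx orbT.
have fS0 : f (ordS ord0, x) = x by rewrite /f /= if_same.
apply: (model_minor (f := f)).
- by move=> h; exists (ord0, h).
- move=> [i a] [j b] fij; have [fx|fx] := eqVneq (f (i, a)) x.
    apply: connect_trans (to0 i a fx) _; rewrite fibre_sym.
    by apply: to0; rewrite -fij.
  move: fij fx; rewrite /f /=.
  case: eqP => [->|_]; last by rewrite eqxx.
  by case: eqP => [->|_] ->; rewrite ?eqxx // connect0.
- move=> h k hk; have [hk_xy|hk_xy] := boolP ([set h; k] == [set x; y]); last first.
    exists (ord0, h), (ord0, k); split=> //.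
    by rewrite /= /chain_adj eqxx /= /del_edge_adj hk hk_xy.
  have hk' : h != k by apply: contraTneq hk => ->; rewrite adj_irr.
  move/eqP/setP: hk_xy => hk_xy.
  have := hk_xy h; have := hk_xy k; rewrite !inE !eqxx orbT => /esym + /esym.
  case/orP=> /eqP ek /orP[] /eqP eh; move: hk'; rewrite ?ek ?eh ?eqxx // => _.
    by exists (ord0, y), (ordS ord0, x).
  by exists (ordS ord0, x), (ord0, y); rewrite adj_sym.
Qed.

Section Path.
Variable m : nat.
Let P := chain (fun i j : 'I_m => j == i.+1 :> nat).

(** Links join consecutive copies only, so each cut between copies consists of one edge and the
    results on bridges apply. *)
Lemma path_bridge (t : nat) (a b : P) : adj a b -> a.1 < t -> ~~ (b.1 < t) ->
  [/\ a.1.+1 = t, a.2 = y, b.1 = t :> nat & b.2 = x].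
Proof.
case: a b => [i a] [j b] /or3P[/andP[/= /eqP-> _]|/and3P[/= /eqP ji /eqP ay /eqP bx]|].
- by move=> ->.
- by move=> it jt; split=> //; lia.
- by case/and3P=> /= /eqP ij _ _ it jt; lia.
Qed.

(* The last cut up to which every branch set reaches from the left singles out
   one copy of [H - xy] that meets every branch set, hence meets each in exactly
   one vertex; both neighbouring links being bridges, all edges of [H] would be
   realised inside that copy, which has one edge too few. *)
Lemma path_minor_free : two_connected H -> minor_free H P.
Proof.
move=> H2 /minor_has_model[f f_model]; have [fS fC fE] := f_model.
have [H3 _ _] := H2.
have crossing t (a b : P) : f a = f b -> f a != None -> a.1 < t -> ~~ (b.1 < t) ->
    exists i j : 'I_m, [/\ i.+1 = t, j = t :> nat, f (i, y) = f a & f (j, x) = f a].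
  move=> ab Na at_ bt.
  have [u [v [/connect_fibre au /andP[uv /eqP fuv] ut vt]]] :=
    connect_crossing (S := fun w : P => w.1 < t) (fC a b ab Na) at_ bt.
  have [u1 u2 v1 v2] := path_bridge uv ut vt.
  exists u.1, v.1; split=> //.
    by rewrite -u2 -surjective_pairing.
  by rewrite -v2 -surjective_pairing -fuv.
pose left t := [forall h, exists w : P, (f w == Some h) && (w.1 < t)].
have exleft : exists t, left t.
  exists m; apply/forallP=> h; have [w fw] := fS h.
  by apply/existsP; exists w; rewrite fw eqxx ltn_ord.
(* The least such [t] is positive because [H] is nonempty. With it renamed [t.+1], copy [t] is the
   one singled out. *)
case: (ex_minnP exleft) => t /forallP left_t min_t.
case: t => [|t] in left_t min_t *.
  have /card_gt0P[h _] : 0 < #|H| by apply: ltn_trans H3.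
  by have /existsP[w] := left_t h; rewrite andbF.
have t_lt_m : t < m.
  apply: min_t; apply/forallP=> h; have [w fw] := fS h.
  by apply/existsP; exists w; rewrite fw eqxx ltn_ord.
pose T := Ordinal t_lt_m.
have squeeze n k : ~~ (n < k) -> n < k.+1 -> k = n by lia.
(* For [t = 0] this is trivial; otherwise it is the dichotomy at the link into copy [t], since by
   minimality [left t] fails. *)
have right_t h : exists w : P, f w = Some h /\ ~~ (w.1 < t).
  case: (posnP t) => [->|t0]; first by have [w fw] := fS h; exists w.
  have t1_lt_m : t.-1 < m by lia.
  pose T1 := Ordinal t1_lt_m.
  have br (a b : P) : adj a b -> a.1 < t -> ~~ (b.1 < t) -> a = (T1, y) /\ b = (T, x).
    move=> ab at_ bt; have [a1 a2 b1 b2] := path_bridge ab at_ bt.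
    move: a b {ab at_ bt} a1 a2 b1 b2 => [i a] [j b] /= it -> jt ->.
    by split; congr pair; apply: val_inj => //=; rewrite -it.
  have [all_left|] := bridge_dichotomy H2 f_model br; last exact.
  suff /min_t : left t by rewrite ltnn.
  apply/forallP=> h'; have [w [fw wt]] := all_left h'.
  by apply/existsP; exists w; rewrite fw eqxx.
have meet_t h : exists p, f (T, p) = Some h.
  have /existsP[u /andP[/eqP fu ut]] := left_t h.
  have [v [fv vt]] := right_t h.
  have [ut'|ut'] := boolP (u.1 < t).
    have [i [j [_ jt _ fj]]] := crossing t u v (etrans fu (esym fv)) ltac:(by rewrite fu) ut' vt.
    by exists x; rewrite -fu -fj; congr (f (_, _)); apply: val_inj.
  exists u.2; rewrite -fu [in RHS](surjective_pairing u); congr (f (_, _)).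
  by apply: val_inj; exact: squeeze ut' ut.
have [r fr] := choice meet_t.
have r_inj : injective r by move=> h k /(congr1 (fun p => f (T, p))); rewrite !fr => -[].
have [r' r'K rK] := injF_bij r_inj.
have r_uniq p h : f (T, p) = Some h -> p = r h by rewrite -{1}(rK p) fr => -[<-].
(* If [a] is left of copy [T], the branch set of [h] contains [(T, x)]; so does that of [k], whether
   [b] is also left or [ab] is the link into [T]. To the right the same happens with [(T, y)]. *)
have inside h k (a b : P) : f a = Some h -> f b = Some k -> adj a b -> h != k -> a.1 = T.
  move=> fa fb ab hk; apply/eqP/negPn/negP=> aT.
  have [at_|at_] := ltnP a.1 t.
    have [i [j [_ jt _ fj]]] := crossing t a (T, r h) (etrans fa (esym (fr h)))
      ltac:(by rewrite fa) at_ ltac:(by rewrite ltnn).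
    have {i fj}xr : x = r h.
      by apply: r_uniq; rewrite -fa -fj; congr (f (_, _)); apply: val_inj.
    have [bt|bt] := boolP (b.1 < t).
      have [i' [j' [_ jt' _ fj']]] := crossing t b (T, r k) (etrans fb (esym (fr k)))
        ltac:(by rewrite fb) bt ltac:(by rewrite ltnn).
      have xk : x = r k.
        by apply: r_uniq; rewrite -fb -fj'; congr (f (_, _)); apply: val_inj.
      by move: hk; rewrite xk in xr; rewrite (r_inj _ _ xr) eqxx.
    have [_ _ b1 b2] := path_bridge ab at_ bt.
    have xk : x = r k.
      by apply: r_uniq; rewrite -fb [in RHS](surjective_pairing b) b2; congr (f (_, _)); apply: val_inj.
    by move: hk; rewrite xk in xr; rewrite (r_inj _ _ xr) eqxx.
  have {aT at_}ta : ~~ (a.1 < t.+1).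
    by apply: contraNN aT => at'; apply/eqP/esym/val_inj; apply: squeeze at'; rewrite -leqNgt.
  have [i [j [it _ fi _]]] := crossing t.+1 (T, r h) a (etrans (fr h) (esym fa))
    ltac:(by rewrite fr) (leqnn _) ta.
  have {fi}yr : y = r h.
    by apply: r_uniq; rewrite -(fr h) -fi; congr (f (_, _)); apply: val_inj; case: it.
  have [bt|bt] := boolP (b.1 < t.+1).
    have [b1 b2 _ _] := path_bridge ltac:(by rewrite adj_sym; exact: ab) bt ta.
    have yk : y = r k.
      apply: r_uniq; rewrite -fb [in RHS](surjective_pairing b) b2; congr (f (_, _)).
      by apply: val_inj; case: b1.
    by move: hk; rewrite yk in yr; rewrite (r_inj _ _ yr) eqxx.
  have [i' [j' [it' _ fi' _]]] := crossing t.+1 (T, r k) b (etrans (fr k) (esym fb))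
    ltac:(by rewrite fr) (leqnn _) bt.
  have yk : y = r k.
    by apply: r_uniq; rewrite -(fr k) -fi'; congr (f (_, _)); apply: val_inj; case: it'.
  by move: hk; rewrite yk in yr; rewrite (r_inj _ _ yr) eqxx.
have edge h k : adj h k -> del_edge_adj x y (r h) (r k).
  move=> hk; have [a [b [fa fb ab]]] := fE h k hk.
  have hk' : h != k by apply: contraTneq hk => ->; rewrite adj_irr.
  have aT := inside h k a b fa fb ab hk'.
  have bT : b.1 = T by apply: (inside k h b a); rewrite // 1?adj_sym // eq_sym.
  case: a b aT bT fa fb ab => [i a] [j b] /= -> -> fa fb.
  rewrite /chain_adj /link /= eqxx (r_uniq _ _ fa) (r_uniq _ _ fb).
  by case/or3P=> // /andP[/eqP/= tt1]; lia.
pose E := [set e : H * H | adj e.1 e.2].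
pose E' := [set e : H * H | del_edge_adj x y e.1 e.2].
have : #|E'| < #|E|.
  apply: proper_card; apply/properP; split.
    by apply/fintype.subsetP=> e; rewrite !inE => /andP[].
  by exists (x, y); rewrite !inE //= /del_edge_adj eqxx andbF.
have rr_inj : injective (fun e : H * H => (r e.1, r e.2)).
  by move=> [a b] [c d] /= [/r_inj-> /r_inj->].
rewrite ltnNge -(card_imset _ rr_inj) => /negP[]; apply: subset_leq_card.
by apply/fintype.subsetP=> _ /imsetP[e + ->]; rewrite !inE; exact: edge.
Qed.

End Path.
End Chain.

(* A view in a chain depends only on the labels of the piece, of its successor
   (at [y]) and of its predecessor (at [x]). *)
Section Views.
Variables (H : sgraph) (x y : H) (xy : adj x y) (A : verifier).
Variables (T : Type) (ident : T -> H -> nat) (cert : T -> H -> bitstring).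

Definition chain_id (I : finType) (nx : rel I) (lab : I -> T) (v : chain xy nx) :=
  ident (lab v.1) v.2.

Definition chain_cert (I : finType) (nx : rel I) (lab : I -> T) (v : chain xy nx) :=
  cert (lab v.1) v.2.

Lemma chain_accepts (I J : finType) (nx : rel I) (nx' : rel J)
    (lab : I -> T) (lab' : J -> T) i j h :
    lab i = lab' j ->
    (h = y -> exists i1 j1,
       [/\ nx i =1 pred1 i1, nx' j =1 pred1 j1 & lab i1 = lab' j1]) ->
    (h = x -> exists i1 j1,
       [/\ nx^~ i =1 pred1 i1, nx'^~ j =1 pred1 j1 & lab i1 = lab' j1]) ->
  accepts A (chain_id (nx := nx) lab) (chain_cert lab) (i, h) =
  accepts A (chain_id (nx := nx') lab') (chain_cert lab') (j, h).
Proof.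
move=> ij hy hx; rewrite /accepts /chain_id /chain_cert /= ij; congr (A _ _ _).
apply/fsetP=> e; apply/imfsetP/imfsetP => /= -[[k b]].
- rewrite !inE => /or3P[/andP[/= /eqP <- hb]|/and3P[/= ik /eqP hE /eqP bE]|/and3P[/= ki /eqP bE /eqP hE]] ->.
  + by exists (j, b); rewrite ?inE /= ?ij // /chain_adj /= eqxx hb.
  + have [i1 [j1 [iE jE lab1]]] := hy hE; exists (j1, b); last first.
      by move: ik; rewrite iE => /eqP->; rewrite lab1.
    by rewrite inE /chain_adj /link /= hE bE jE /= !eqxx orbT.
  + have [i1 [j1 [iE jE lab1]]] := hx hE; exists (j1, b); last first.
      by move: ki; rewrite iE => /eqP->; rewrite lab1.
    by rewrite inE /chain_adj /link /= hE bE jE /= !eqxx !orbT.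
- rewrite !inE => /or3P[/andP[/= /eqP <- hb]|/and3P[/= jk /eqP hE /eqP bE]|/and3P[/= kj /eqP bE /eqP hE]] ->.
  + by exists (i, b); rewrite ?inE /= ?ij // /chain_adj /= eqxx hb.
  + have [i1 [j1 [iE jE lab1]]] := hy hE; exists (i1, b); last first.
      by move: jk; rewrite jE => /eqP->; rewrite lab1.
    by rewrite inE /chain_adj /link /= hE bE iE /= !eqxx orbT.
  + have [i1 [j1 [iE jE lab1]]] := hx hE; exists (i1, b); last first.
      by move: kj; rewrite jE => /eqP->; rewrite lab1.
    by rewrite inE /chain_adj /link /= hE bE iE /= !eqxx !orbT.
Qed.

End Views.

(** * Counting orders and certificates *)

(* Deleting [m] from such a sequence is undone by reinserting it before its old
   successor, for which the bounded steps back leave at most [L] choices. *)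
Lemma size_bounded_back_steps (L m : nat) (ss : seq (seq nat)) :
    0 < L -> uniq ss ->
    {in ss, forall s, perm_eq s (iota 0 m) && sorted (fun p q => p < q + L) s} ->
  size ss <= L ^ m.
Proof.
move=> L0; elim: m => [|m IHm] in ss *.
  move=> Uss ss0; apply: (@uniq_leq_size _ ss [:: [::]]) => // s /ss0/andP[/perm_size].
  by case: s.
move=> Uss ssP; set r := fun p q : nat => _ in ssP.
(* [m] is recorded by its distance to its successor, a number from 1 to [L - 1]; the default [m] of
   [nth] turns this into 0 when [m] comes last. *)
pose enc s := (rem m s, m - nth m s (index m s).+1).
(* For the code 0 the search for [m] fails, [index] returns the length, and [m] goes back to the
   end. *)
pose dec (wc : seq nat * nat) :=
  let k := index (m - wc.2) wc.1 in take k wc.1 ++ m :: drop k wc.1.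
have split_m s : s \in ss -> exists s1 s2,
    [/\ s = s1 ++ m :: s2, rem m s = s1 ++ s2, perm_eq (s1 ++ s2) (iota 0 m)
      & nth m s (index m s).+1 = head m s2].
  case/ssP/andP=> sm _.
  have ms : m \in s by rewrite (perm_mem sm) mem_iota /=.
  case/splitPr: ms sm => s1 s2 sm.
  have Us : uniq (s1 ++ m :: s2) by rewrite (perm_uniq sm) iota_uniq.
  have ms1 : m \notin s1.
    by move: Us; rewrite cat_uniq /= negb_or => /and3P[_ /andP[]].
  exists s1, s2; rewrite remE index_cat (negPf ms1) /= eqxx addn0.
  rewrite take_size_cat // drop_cat ltnNge leqnSn /= subSnn /= drop0.
  split=> //; last by rewrite nth_cat ltnNge leqnSn /= subSnn /= nth0.
  by have := sm; rewrite -addn1 iotaD /= -cat1s perm_catCA perm_sym perm_catC perm_cons perm_sym.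
have encK : {in ss, cancel enc dec}.
  move=> s /split_m[s1 [s2 [sE remE' w_perm nthE]]].
  have memw z : (z \in s1 ++ s2) = (z < m) by rewrite (perm_mem w_perm) mem_iota.
  have headE : m - (m - head m s2) = head m s2.
    rewrite subKn //; case: s2 memw {sE remE' w_perm nthE} => //= z s2 memw.
    by apply: ltnW; rewrite -memw mem_cat inE eqxx orbT.
  have indexE : index (head m s2) (s1 ++ s2) = size s1.
    have Uw : uniq (s1 ++ s2) by rewrite (perm_uniq w_perm) iota_uniq.
    case: s2 memw Uw {sE remE' w_perm nthE headE} => [|z s2] memw.
      by rewrite cats0 in memw *; move=> _; apply: memNindex; rewrite memw ltnn.
    rewrite cat_uniq /= negb_or => /and3P[_ /andP[zs1 _] _].
    by rewrite index_cat (negPf zs1) /= eqxx addn0.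
  by rewrite /dec /enc /= nthE headE remE' indexE take_size_cat ?drop_size_cat.
pose ws := undup [seq rem m s | s <- ss].
have ws_size : size ws <= L ^ m.
  apply: IHm; first exact: undup_uniq.
  move=> w; rewrite mem_undup => /mapP[s sss ->].
  have [s1 [s2 [sE -> w_perm _]]] := split_m s sss; rewrite w_perm /=.
  have memw z : (z \in s1 ++ s2) = (z < m) by rewrite (perm_mem w_perm) mem_iota.
  have /andP[_] := ssP s sss; rewrite sE.
  case: s1 memw {sE w_perm} => [|z s1] memw /=; first exact: path_sorted.
  rewrite !cat_path /= => /and3P[-> last_m]; case: s2 memw => //= z' s2 memw.
  (* As [m] exceeds every other entry, its predecessor inherits the bound on the step back from [m]
     to its successor. *)
  case/andP=> mz' ->; rewrite andbT; apply: leq_ltn_trans mz'.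
  by apply: ltnW; rewrite -memw -cat_cons mem_cat mem_last.
rewrite -(size_map enc) expnSr.
apply: (@leq_trans (size [seq (w, c) | w <- ws, c <- iota 0 L])); last first.
  by rewrite size_allpairs size_iota leq_mul2r ws_size orbT.
apply: uniq_leq_size; first by rewrite map_inj_in_uniq //; exact: can_in_inj encK.
move=> _ /mapP[s sss ->]; apply/allpairsP; exists (enc s); split=> //=.
  by rewrite mem_undup map_f.
have [s1 [s2 [sE _ _ ->]]] := split_m s sss; rewrite mem_iota /= add0n.
have /andP[_] := ssP s sss; rewrite sE.
case: s2 {sE} => [|z s2] /=; first by rewrite subnn.
by move/cat_sorted2=> [_ /= /andP[+ _]]; rewrite /r; lia.
Qed.

Lemma card_perm_fibre (m L : nat) (C : finType) (col : {perm 'I_m} -> C) :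
  #|C| * L < m`! -> exists c, L < #|[set s | col s == c]|.
Proof.
move=> CL; have [/existsP[c]|Nc] := boolP [exists c, L < #|[set s | col s == c]|].
  by exists c.
suff : m`! <= #|C| * L by rewrite leqNgt CL.
rewrite -card_Sn -sum1_card (partition_big col predT) //= -sum_nat_const.
apply: leq_sum => c _; rewrite sum1_card leqNgt.
apply: contra Nc => Lc; apply/existsP; exists c; apply: leq_trans Lc _.
by apply: eq_leq; apply: eq_card => s; rewrite !inE.
Qed.

(** By pigeonhole some colour class has more than [L ^ m] orders; written as positions in a fixed
    member [s], they cannot all avoid steps back of [L] or more. Here [t], [t1] are positions in
    [s'], and [q], [p] those of the same copies in [s]. *)
Lemma two_perms_back_step (m L : nat) (C : finType) (col : {perm 'I_m} -> C) :
    0 < L -> #|C| * L ^ m < m`! ->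
  exists (s s' : {perm 'I_m}) (p q t t1 : 'I_m),
    [/\ col s = col s', t1 = t.+1 :> nat, s' t = s q, s' t1 = s p & p + L <= q].
Proof.
move=> L0 /(card_perm_fibre col)[c].
set F := [set _ | _] => LF.
have /card_gt0P[s] : 0 < #|F| by apply: leq_ltn_trans LF.
rewrite inE => /eqP sc.
pose sq (s' : {perm 'I_m}) := [seq val ((s^-1)%g (s' t)) | t <- enum 'I_m].
have [/existsP[s' /existsP[t /existsP[t1 /and3P[]]]]|Nback] := boolP [exists s' : {perm 'I_m},
    exists t : 'I_m, exists t1 : 'I_m,
    [&& s' \in F, t1 == t.+1 :> nat & (s^-1)%g (s' t1) + L <= (s^-1)%g (s' t)]].
  rewrite inE => /eqP s'c /eqP tt1 back.
  exists s, s', ((s^-1)%g (s' t1)), ((s^-1)%g (s' t)), t, t1.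
  by rewrite !permKV sc s'c.
exfalso; move: LF; apply/negP; rewrite -leqNgt cardE -(size_map sq).
apply: (size_bounded_back_steps L0).
  rewrite map_inj_uniq ?enum_uniq // => a b ab.
  apply/permP=> t; apply: (@perm_inj _ (s^-1)%g); apply: val_inj.
  by move/eq_in_map: ab => -> //; rewrite mem_enum.
move=> _ /mapP[s' s'F ->]; apply/andP; split; last first.
  apply/(sortedP 0) => i; rewrite size_map size_enum_ord => i1_lt_m.
  have i_lt_m : i < m by apply: ltnW.
  have nthE k (kt : k < m) : nth 0 (sq s') k = (s^-1)%g (s' (Ordinal kt)).
    have ke : k < size (enum 'I_m) by rewrite size_enum_ord.
    rewrite (nth_map (Ordinal kt) _ _ ke); congr (val ((s^-1)%g (s' _))).
    by apply: val_inj; rewrite /= nth_enum_ord.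
  rewrite (nthE _ i_lt_m) (nthE _ i1_lt_m) ltnNge.
  apply: contra Nback => back; apply/existsP; exists s'.
  apply/existsP; exists (Ordinal i_lt_m); apply/existsP; exists (Ordinal i1_lt_m).
  by rewrite -mem_enum s'F eqxx.
have -> : sq s' = map val [seq (s^-1)%g (s' t) | t <- enum 'I_m].
  by rewrite -map_comp.
rewrite -val_enum_ord; apply: perm_map.
apply: uniq_perm; rewrite ?enum_uniq //.
  by rewrite map_inj_uniq ?enum_uniq // => a b /perm_inj/perm_inj.
move=> t; rewrite mem_enum; apply/mapP; exists ((s'^-1)%g (s t)).
  by rewrite mem_enum.
by rewrite permKV permK.
Qed.

Lemma leq_exp_fact p k : p ^ k <= (p + k)`!.
Proof.
elim: k => [|k IHk]; first by rewrite fact_gt0.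
by rewrite addnS factS expnS leq_mul // -addnS leq_addr.
Qed.

(** Here [m = 4 ^ a.+1], [L = 2 ^ a.+1], and a copy carries [e] bits. Up to the factor [4 ^ a], the
    exponent [4 * (e + a + 1)] of 2 is compared with [6 * a], which comes from
    [(4 ^ a) ^ (3 * 4 ^ a)]. *)
Lemma exp2_lt_fact a e : 2 * e + 2 < a ->
  2 ^ (e * 4 ^ a.+1) * (2 ^ a.+1) ^ (4 ^ a.+1) < (4 ^ a.+1)`!.
Proof.
move=> ea; have -> : (4 ^ a.+1)`! = (4 ^ a + 3 * 4 ^ a)`! by rewrite expnS -mulSn.
apply: leq_trans (leq_exp_fact _ _); rewrite -expnM -expnD -mulnDl.
rewrite -[4]/(2 ^ 2) -!expnM ltn_exp2l // mulnS expnD -[2 ^ 2]/4.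
have : 0 < 2 ^ (2 * a) by rewrite expn_gt0.
nia.
Qed.

Lemma card_bseq_bool_leq n : #|{: n.-bseq bool}| <= 2 ^ n.+1.
Proof.
rewrite card_bseq card_bool; elim: n => [|n IHn]; first by rewrite big_ord1.
by rewrite big_ord_recr /= [in leqRHS]expnS mul2n -addnn leq_add2r.
Qed.

Lemma littleo_ln_scale (R : realType) (g : nat -> nat) (s : nat) : 0 < s ->
    ((fun n : nat => ((g n)%:R : R)%R) =o_\oo (fun n : nat => (ln n%:R : R)%R))%classic ->
  exists a, 2 * ((g (4 ^ a.+1 * s)).+1 * s) + 2 < a.
Proof.
move=> s0 /eqoP /(_ (8 * s%:R)^-1%R) [|N _ HN].
  by rewrite invr_gt0 mulr_gt0 // ltr0n.
(* Past the threshold [N], [8 * s * g n <= ln n <= 3 * a.+1 + s], using [ln 4 <= 3] and [ln s <= s];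
   the goal then follows from [9 * s + 11 < a]. *)
exists (N + 9 * s + 12); set a := N + _ + _; set n := 4 ^ a.+1 * s.
have Nn : N <= n.
  apply: (@leq_trans (4 ^ a.+1)); last by rewrite leq_pmulr.
  by apply: leq_trans (ltnW (ltn_expl _ _)); rewrite // /a; lia.
have := HN n Nn; rewrite /= ger0_norm ?ler0n //.
have n1 : (1 <= n%:R :> R)%R by rewrite ler1n muln_gt0 expn_gt0.
rewrite ger0_norm ?ln_ge0 // mulrC ler_pdivlMr; last by rewrite mulr_gt0 // ltr0n.
have ln_n : (ln n%:R <= (3 * a.+1 + s)%:R :> R)%R.
  rewrite /n natrM natrX lnM ?posrE ?exprn_gt0 ?ltr0n // lnXn ?ltr0n //.
  rewrite natrD; apply: lerD; last first.
    have /ln_sublinear : (0 < s%:R :> R)%R by rewrite ltr0n.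
    lra.
  rewrite natrM mulr_natr ler_wMn2r // .
  by have := @le_ln1Dx R 3; rewrite -[(1 + 3)%R]/(4%:R)%R; apply; lra.
move=> /le_trans/(_ ln_n); rewrite -!natrM ler_nat.
rewrite /a; nia.
Qed.

(** * Closing a segment into a ring *)

Lemma connect_ord (m : nat) (e : rel 'I_m) : symmetric e ->
  (forall i j : 'I_m, j = i.+1 :> nat -> e i j) -> forall i j, connect e i j.
Proof.
move=> e_sym eS; suff up (i j : 'I_m) : i <= j -> connect e i j.
  move=> i j; case: (leqP i j) => [|/ltnW]; first exact: up.
  by rewrite (sym_connect_sym e_sym); exact: up.
case: j => j; elim: j => [|j IHj] j_lt_m; rewrite leq_eqVlt => /orP[/eqP ij|//].
- by rewrite (_ : i = Ordinal j_lt_m) ?connect0 //; exact: val_inj.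
- by rewrite (_ : i = Ordinal j_lt_m) ?connect0 //; exact: val_inj.
rewrite ltnS => ij; apply: connect_trans (IHj (ltnW j_lt_m) ij) _.
by apply: connect1; exact: eS.
Qed.

Lemma val_ordS (l : nat) (i : 'I_l.+1) : i < l -> ordS i = i.+1 :> nat.
Proof. by move=> il /=; rewrite modn_small. Qed.

Section Ring.
Variables (H : sgraph) (x y : H) (xy : adj x y) (A : verifier) (m : nat).
Variables (ident : 'I_m -> H -> nat) (cert : 'I_m -> H -> bitstring).
Let nx (i j : 'I_m) := j == i.+1 :> nat.

Definition path_accepted (s : {perm 'I_m}) := forall v,
  accepts A (chain_id (xy := xy) (nx := nx) ident s)
            (chain_cert (xy := xy) (nx := nx) cert s) v.

(* The segment of [s] from [p] to [q] closes up: its closing link occurs in the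
   path ordered by [s'], all other links occur in the path ordered by [s]. *)
Lemma ring_accepted (s s' : {perm 'I_m}) (p q t t1 : 'I_m)
    (pos : 'I_(q - p).+1 -> 'I_m) (v : chain xy (fun i j : 'I_(q - p).+1 => j == ordS i)) :
    path_accepted s -> path_accepted s' -> t1 = t.+1 :> nat ->
    s' t = s q -> s' t1 = s p -> p < q -> (forall r, pos r = p + r :> nat) ->
  accepts A (chain_id (xy := xy) ident (fun r => s (pos r)))
            (chain_cert cert (fun r => s (pos r))) v.
Proof.
move=> acc acc' t1E s't s't1 pq posE; have xNy := edge_neq xy.
have nxE (i j : 'I_m) : j = i.+1 :> nat -> nx i =1 pred1 j.
  by move=> ij z; rewrite /nx -ij.
have nxE' (i j : 'I_m) : j = i.+1 :> nat -> nx^~ j =1 pred1 i.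
  by move=> ij z; rewrite /nx /= ij eqSS eq_sym.
have pos0 : pos ord0 = p by apply: val_inj; rewrite /= posE addn0.
have posl : pos ord_max = q by apply: val_inj; rewrite /= posE /= subnKC // ltnW.
have S_max : ordS (ord_max : 'I_(q - p).+1) = ord0 by apply: val_inj; rewrite /= modnn.
have ringE (i j : 'I_(q - p).+1) : j = ordS i -> (fun z => j == ordS z) =1 pred1 i.
  by move=> -> z /=; rewrite (inj_eq (@ordS_inj _)) eq_sym.
case: v => r h; have [->|hy] := eqVneq h y.
  (* At [y] of the last copy the view comes from [s'], where [s q] is directly followed by [s p];
     the same holds below at [x] of the first copy. *)
  have [->|rl] := eqVneq r ord_max.
    rewrite (@chain_accepts _ _ _ _ _ _ _ _ _ _ _ nx _ s' _ t) ?posl //.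
      by move=> _; exists ord0, t1; split; rewrite ?S_max ?pos0 //; exact: nxE.
    by move=> yx; rewrite yx eqxx in xNy.
  have r_lt : r < q - p.
    by rewrite ltn_neqAle -ltnS ltn_ord andbT; apply: contra rl => /eqP rq; apply/eqP/val_inj.
  rewrite (@chain_accepts _ _ _ _ _ _ _ _ _ _ _ nx _ s _ (pos r)) //.
    move=> _; exists (ordS r), (pos (ordS r)); split=> //.
    by apply: nxE; rewrite !posE val_ordS // addnS.
  by move=> yx; rewrite yx eqxx in xNy.
have [->|hx] := eqVneq h x; last first.
  rewrite (@chain_accepts _ _ _ _ _ _ _ _ _ _ _ nx _ s _ (pos r)) //.
    by move=> hE; rewrite hE eqxx in hy.
  by move=> hE; rewrite hE eqxx in hx.
have [->|r0] := eqVneq r ord0.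
  rewrite (@chain_accepts _ _ _ _ _ _ _ _ _ _ _ nx _ s' _ t1) ?pos0 //.
    by move=> xE; rewrite xE eqxx in xNy.
  move=> _; exists ord_max, t; split; rewrite ?posl //; last exact: nxE'.
  exact: ringE.
have r1_lt : r.-1 < (q - p).+1 by apply: leq_ltn_trans (ltn_ord r); exact: leq_pred.
have r_gt0 : 0 < r by rewrite lt0n; apply: contra r0 => /eqP r0; apply/eqP/val_inj.
have rS : ordS (Ordinal r1_lt) = r.
  by apply: ord_inj; rewrite val_ordS /= ?prednK // -ltnS.
rewrite (@chain_accepts _ _ _ _ _ _ _ _ _ _ _ nx _ s _ (pos r)) //.
  by move=> xE; rewrite xE eqxx in xNy.
move=> _; exists (Ordinal r1_lt), (pos (Ordinal r1_lt)); split=> //.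
  exact: ringE.
by apply: nxE'; rewrite !posE /= -addnS prednK.
Qed.

End Ring.

(** * The lower bound on certificate sizes *)

Theorem theorem45 (R : realType) (H : sgraph) (k : nat) (g : nat -> nat) :
  two_connected H ->
  (1 < k)%N ->
  ((fun n : nat => ((g n)%:R : R)%R) =o_\oo (fun n : nat => (ln n%:R : R)%R))%classic ->
  ~ certifiable k (minor_free H) g.
Proof.
move=> H2 k1 g_ln [A [complete sound]].
have [x [y xy]] := two_connected_edge H2.
pose s := #|H|; have s_gt0 : 0 < s by case: H2 => H3 _ _; apply: leq_trans H3.
have [a a_gt] := littleo_ln_scale s_gt0 g_ln.
pose m := 4 ^ a.+1; pose L := 2 ^ a.+1; pose n := m * s.
rewrite -/m -/n in a_gt.
have mL : m = L * L by rewrite /m /L -expnMn.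
have L_gt0 : 0 < L by rewrite expn_gt0.
pose nx (i j : 'I_m) := j == i.+1 :> nat.
pose P := chain xy nx.
have cardP : #|P| = n by rewrite card_prod card_ord.
(* Identifiers belong to the copy, not to its position: copy [j] owns the [s] numbers from
   [j * s + 1] on in every order. *)
pose ident (j : 'I_m) (h : H) := (j * s + enum_rank h).+1.
have ident_inj j h j' h' : ident j h = ident j' h' -> j = j' /\ h = h'.
  case=> /eqP; rewrite -/s => /eqP jh.
  have jj : j = j' :> nat.
    have := congr1 (divn^~ s) jh.
    by rewrite !divnMDl // !divn_small ?ltn_ord // !addn0.
  split; first exact: val_inj.
  by apply/enum_rank_inj/val_inj; move: jh; rewrite jj => /addnI.
have ident_le j h : ident j h <= n.
  apply: (@leq_trans (j * s + s)); first by rewrite ltn_add2l ltn_ord.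
  by rewrite addnC -mulSn leq_mul2r ltn_ord orbT.
have chain_ids (I : finType) (nx' : rel I) (lab : I -> 'I_m) :
    injective lab -> n <= (#|I| * s) ^ k -> valid_ids k (chain_id (xy := xy) (nx := nx') ident lab).
  move=> lab_inj n_le; split.
    by move=> [i h] [j h'] /ident_inj[/lab_inj /= -> ->].
  move=> v; rewrite /chain_id ltn0Sn card_prod.
  exact: leq_trans (ident_le _ _) n_le.
have accP (t : {perm 'I_m}) : exists c : P -> bitstring,
    (forall v, size (c v) <= g n) /\ (forall v, accepts A (chain_id ident t) c v).
  rewrite -cardP; apply: complete.
  - apply: chain_connected => //; first by rewrite card_ord expn_gt0.
    apply: connect_ord => [i j|i j ij]; first by rewrite orbC.
    by rewrite /nx ij eqxx.
  - exact: path_minor_free.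
  - apply: chain_ids; first exact: perm_inj.
    by rewrite card_ord -[leqLHS]expn1 leq_pexp2l ?muln_gt0 ?expn_gt0 // ltnW.
have [C CP] := choice accP.
(* Certificates are listed by copy: [(t^-1)%g j] is the position of copy [j] in the order [t]. The
   size bound keeps [insub_bseq] from using its default. *)
pose col (t : {perm 'I_m}) : {ffun 'I_m * H -> (g n).-bseq bool} :=
  [ffun jh => insub_bseq (g n) (C t ((t^-1)%g jh.1, jh.2))].
have colE t t' j h : col t = col t' -> C t ((t^-1)%g j, h) = C t' ((t'^-1)%g j, h).
  move/ffunP/(_ (j, h)); rewrite !ffunE /= => /(congr1 val).
  by rewrite /insub_bseq !val_insubd !(proj1 (CP _)).
(* Each of the [m * s] vertices has at most [2 ^ (g n).+1] certificates, hence [e = (g n).+1 * s]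
   bits per copy. *)
have few_colours : #|{ffun 'I_m * H -> (g n).-bseq bool}| * L ^ m < m`!.
  apply: leq_ltn_trans (exp2_lt_fact a_gt); rewrite leq_mul2r; apply/orP; right.
  have -> : (g n).+1 * s * 4 ^ a.+1 = (g n).+1 * n by rewrite -mulnA [s * _]mulnC.
  rewrite card_ffun card_prod card_ord.
  by rewrite [leqRHS]expnM leq_exp2r ?muln_gt0 ?expn_gt0 ?s_gt0 // card_bseq_bool_leq.
have [t [t' [p [q [i [i1 [tt' i1E t'i t'i1 pq]]]]]]] := two_perms_back_step col L_gt0 few_colours.
pose cert j h := C t ((t^-1)%g j, h).
have acc : path_accepted xy A ident cert t.
  rewrite /path_accepted (_ : chain_cert cert t = C t); first exact: (CP t).2.
  by apply/funext => -[j h]; rewrite /chain_cert /cert /= permK.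
have acc' : path_accepted xy A ident cert t'.
  rewrite /path_accepted (_ : chain_cert cert t' = C t'); first exact: (CP t').2.
  by apply/funext => -[j h]; rewrite /chain_cert /cert /= (colE _ _ _ _ tt') permK.
have pos_lt (r : 'I_(q - p).+1) : p + r < m.
  by apply: leq_ltn_trans (ltn_ord q); have := ltn_ord r; lia.
pose pos r := Ordinal (pos_lt r).
have pos_inj : injective pos by move=> r r' [/addnI/val_inj].
have [||| v] := sound (chain xy (fun i j : 'I_(q - p).+1 => j == ordS i))
  (chain_id ident (fun r => t (pos r))) (chain_cert cert (fun r => t (pos r))).
- apply: chain_connected => //; first by rewrite card_ord.
  apply: connect_ord => [j j'|j j' jj']; first by rewrite orbC.
  apply/orP; left; apply/eqP/ord_inj; rewrite val_ordS //.
  by rewrite -ltnS -jj' ltn_ord.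
- by apply; exact: ring_minor.
- apply: chain_ids; first by move=> r r' /perm_inj/pos_inj.
  (* The ring has more than [L] copies and [m = L * L], so the square of its size is at least [n];
     [1 < k] makes this enough. *)
  rewrite card_ord; apply: (@leq_trans (((q - p).+1 * s) ^ 2)); last first.
    by rewrite leq_pexp2l // muln_gt0.
  have Lq : L <= (q - p).+1 by lia.
  have mq : m <= (q - p).+1 ^ 2 by apply: leq_trans (leq_mul Lq Lq); rewrite -mL.
  by rewrite expnMn leq_mul // -[leqLHS]expn1 leq_pexp2l.
apply/negP/negPn; apply: (ring_accepted (s' := t') (t := i) (t1 := i1)) => //.
by apply: leq_trans pq; rewrite -[leqLHS]addn1 leq_add2l.
Qed.
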